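(* For every finite regular matroid $\mathcal M$ (with a fixed totally unimodular representing matrix $M$), the face poset $\mathcal{FP}(\mathcal M)$ of the Voronoi cell $V_0$ of the lattice of integer flows $\Lambda(\mathcal M)$ is isomorphic, as a graded poset, to the poset $\mathcal{SC}(\mathcal M)$ of strongly connected orientations of submatroids of $\mathcal M$. More precisely, there is an order-preserving bijection $\phi:\mathcal{FP}(\mathcal M)\to\mathcal{SC}(\mathcal M)$ such that every face $F$ satisfies $\operatorname{codim}(F)=\operatorname{genus}(\phi(F))$, equivalently $\dim F=\operatorname{genus}(\mathcal M)-\operatorname{genus}(\phi(F))$.
   Context: Let $\mathcal M$ be a regular matroid on a finite ground set $E$, represented over $\mathbb R$ by a totally unimodular (TU) matrix $M$ (every square submatrix has determinant in $\{-1,0,1\}$) whose columns $c_e$ are indexed by $e\in E$. Identify $\mathbb R^E$ with standard basis $\{e\}_{e\in E}$, Euclidean inner product $\langle\cdot,\cdot\rangle$ and norm $\|\cdot\|$. Let $\mathcal F=\mathcal F(\mathcal M)=\ker M\subseteq\mathbb R^E$ (real flows) and $\Lambda=\Lambda(\mathcal M)=\ker M\cap\mathbb Z^E$ (integer flows). For $x\in\mathbb R^E$ write $x_e=\langle x,e\rangle$ and $\operatorname{supp}(x)=\{e: x_e\neq 0\}$. $\operatorname{genus}(\mathcal M)=\dim\mathcal F$. The Voronoi cell of $\lambda\in\Lambda$ is $V_\lambda=\{x\in\mathcal F:\|x-\lambda\|\le\|x-\mu\|\ \forall\mu\in\Lambda\}$. $\mathcal{FP}(\mathcal M)$ is the set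 of nonempty faces of the polytope $V_0$ ordered by inclusion, graded by dimension; codimension is taken in $\mathcal F$. An oriented submatroid is a pair $(S,\varepsilon)$ with $S\subseteq E$ and $\varepsilon:S\to\{\pm1\}$. It is strongly connected if for every $e\in S$ there is $w\in\mathbb Z_{\ge0}^S$ with $w_e\ge1$ and $\sum_{f\in S}w_f\varepsilon_f c_f=0$ (i.e. every element lies in a positive integer flow of the reoriented submatrix). The genus of $(S,\varepsilon)$ is the dimension of the kernel of the submatrix $M_S$ of $M$ formed by the columns indexed by $S$. $\mathcal{SC}(\mathcal M)$ is the set of strongly connected oriented submatroids (including $(\emptyset,\emptyset)$), ordered by $(S,\varepsilon)\le(S',\varepsilon')$ iff $S'\subseteq S$ and $\varepsilon'=\varepsilon|_{S'}$. *)

(* Defs.v *)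
From HB Require Import structures.
From mathcomp Require Import all_boot all_order all_algebra.
From mathcomp Require Import reals.
Set Implicit Arguments. Unset Strict Implicit. Unset Printing Implicit Defensive.
Import Order.TTheory GRing.Theory Num.Theory.
Local Open Scope ring_scope.

(* Conventions: the ground set E is identified with 'I_n; vectors of R^E are
   row vectors 'rV[R]_n; the representing matrix M : 'M[R]_(m, n) has the
   column c_e = col e M for e : 'I_n. *)

Section Defs.
Variables (R : realType) (m n : nat).
Implicit Types (M : 'M[R]_(m, n)) (x y : 'rV[R]_n).

Definition totally_unimodular M : Prop :=
  forall (k : nat) (f : 'I_k -> 'I_m) (g : 'I_k -> 'I_n),
    injective f -> injective g ->
    let d := \det (mxsub f g M) in d = -1 \/ d = 0 \/ d = 1.

Definition is_flow M x : Prop := M *m x^T = 0.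

Definition is_int_flow M x : Prop :=
  is_flow M x /\ forall i : 'I_n, exists z : int, x 0 i = z%:~R.

Definition euclid_norm x : R := Num.sqrt (\sum_(i < n) x 0 i ^+ 2).

Definition voronoi0 M (x : 'rV[R]_n) : Prop :=
  is_flow M x /\
  forall mu, is_int_flow M mu -> euclid_norm x <= euclid_norm (x - mu).

Definition dotp x y : R := \sum_(i < n) x 0 i * y 0 i.

(* Nonempty faces of a convex set C (C itself included via a = 0, b = 0):
   intersections of C with a supporting hyperplane. *)
Definition is_face (C F : 'rV[R]_n -> Prop) : Prop :=
  (exists x, F x) /\
  exists (a : 'rV[R]_n) (b : R),
    (forall x, C x -> dotp a x <= b) /\
    (forall x, F x <-> (C x /\ dotp a x = b)).

Definition aff_indep_in (S : 'rV[R]_n -> Prop) (d : nat) : Prop :=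
  exists (p0 : 'rV[R]_n) (P : 'M[R]_(d, n)),
    S p0 /\ (forall i, S (p0 + row i P)) /\ row_free P.
Definition has_affdim (S : 'rV[R]_n -> Prop) (d : nat) : Prop :=
  aff_indep_in S d /\ forall d', aff_indep_in S d' -> (d' <= d)%N.

Definition genus M : nat := \rank (kermx M^T).

(* Oriented submatroids (S, eps): encoded as sigma : {ffun 'I_n -> option bool}
   with S = {e | sigma e <> None} and eps e = +1 if sigma e = Some true,
   eps e = -1 if sigma e = Some false.  This is a bijective encoding. *)
Definition osub := {ffun 'I_n -> option bool}.
Definition os_supp (s : osub) : {set 'I_n} := [set e | s e != None].
Definition os_sign (s : osub) (e : 'I_n) : R :=
  match s e with Some true => 1 | Some false => -1 | None => 0 end.

Definition strongly_connected M (s : osub) : Prop :=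
  forall e, e \in os_supp s ->
    exists w : 'I_n -> nat, (1 <= w e)%N /\
      \sum_(f in os_supp s) ((w f)%:R * os_sign s f) *: col f M = 0.

Definition colsub_set M (S : {set 'I_n}) : 'M[R]_(m, #|S|) :=
  colsub (fun i : 'I_#|S| => enum_val i) M.

Definition os_genus M (s : osub) : nat :=
  \rank (kermx (colsub_set M (os_supp s))^T).

Definition os_le (s s' : osub) : Prop :=
  os_supp s' \subset os_supp s /\
  forall e, e \in os_supp s' -> s' e = s e.

End Defs.

(* Main.v *)
Require Import Defs.
From HB Require Import structures.
From mathcomp Require Import all_boot all_order all_algebra.
From mathcomp Require Import reals boolp.
From mathcomp Require Import ring lra.
Set Implicit Arguments. Unset Strict Implicit. Unset Printing Implicit Defensive.
Import Order.TTheory GRing.Theory Num.Theory.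
Local Open Scope ring_scope.

(** By Cramer's rule, every flow of a totally unimodular matrix is a conformal
    nonnegative combination of flows with entries in {-1, 0, 1}. Hence the
    Voronoi cell is cut out of the space of flows by [2 <a, x> <= |a|_1] for
    all real flows [a], and the sign vectors of real flows are exactly the
    strongly connected oriented submatroids. The projection of the cube
    [[-1/2, 1/2]^E] lies in the cell and attains every one of these bounds, so
    the nonempty faces are [F_a = {x | 2 <a, x> = |a|_1}], with [F_a] contained
    in [F_b] iff [b] is conformal to [a]. The directions of [F_a] are the
    projections of the coordinate vectors outside [supp a], whose orthogonal
    complement among the flows consists of the flows supported in [supp a]. *)

(** * Inner product, supports and conformality in [R^E] *)

Section Vectors.
Context {R : realType} {n : nat}.
Implicit Types (a b x y : 'rV[R]_n) (S : {set 'I_n}) (t : R).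

Definition l1norm x : R := \sum_(i < n) `|x 0 i|.

Definition vsupp x : {set 'I_n} := [set e | x 0 e != 0].

Definition conformal b a : Prop :=
  forall e, b 0 e != 0 -> Num.sg (b 0 e) = Num.sg (a 0 e).

Lemma dotpE x y : dotp x y = (x *m y^T) 0 0.
Proof. by rewrite mxE; apply: eq_bigr => i _; rewrite mxE. Qed.

Lemma dotpC x y : dotp x y = dotp y x.
Proof. by apply: eq_bigr => i _; rewrite mulrC. Qed.

Lemma dotpDl x y z : dotp (x + y) z = dotp x z + dotp y z.
Proof. by rewrite !dotpE mulmxDl mxE. Qed.

Lemma dotpZl t x z : dotp (t *: x) z = t * dotp x z.
Proof. by rewrite !dotpE -scalemxAl mxE. Qed.

Lemma dotpBl x y z : dotp (x - y) z = dotp x z - dotp y z.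
Proof. by rewrite dotpDl -scaleN1r dotpZl mulN1r. Qed.

Lemma dotpBr x y z : dotp z (x - y) = dotp z x - dotp z y.
Proof. by rewrite !(dotpC z) dotpBl. Qed.

Lemma dotpp_eq0 x : (dotp x x == 0) = (x == 0).
Proof.
apply/eqP/eqP => [x0|->]; last by rewrite /dotp big1 // => i _; rewrite mxE mul0r.
apply/rowP => i; rewrite mxE; apply/eqP.
have /psumr_eq0P : forall j, true -> 0 <= x 0 j * x 0 j.
  by move=> j _; rewrite -expr2 sqr_ge0.
by move=> /(_ x0 i isT) /eqP; rewrite mulf_eq0 orbb.
Qed.

Lemma vsupp_eq0 x : (vsupp x == set0) = (x == 0).
Proof.
apply/eqP/eqP => [/setP x0|->]; last by apply/setP => i; rewrite !inE mxE eqxx.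
by apply/rowP => i; have := x0 i; rewrite !inE mxE => /negbFE/eqP.
Qed.

Lemma conformal_supp b a : conformal b a -> vsupp b \subset vsupp a.
Proof.
by move=> ba; apply/subsetP => e; rewrite !inE => be; rewrite -sgr_eq0 -ba // sgr_eq0.
Qed.

Lemma conformal_trans b a c : conformal a b -> conformal b c -> conformal a c.
Proof.
move=> ab bc e ae; rewrite ab // bc //.
by have /subsetP/(_ e) := conformal_supp ab; rewrite !inE => ->.
Qed.

(** Subtracting a coordinatewise smaller amount can cancel an entry but never flip its sign,
    whatever the signs of [b]. *)
Lemma conformal_sub a b : (forall e, `|b 0 e| <= `|a 0 e|) -> conformal (a - b) a.
Proof.
move=> ba e; rewrite !mxE => abe; have := ba e.
case: (ltrgtP (a 0 e) 0) => ae.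
- rewrite (ltr0_norm ae) (ltr0_sg ae) ler_norml => /andP[h1 h2].
  by apply: ltr0_sg; rewrite lt_neqAle abe /=; lra.
- rewrite (gtr0_norm ae) (gtr0_sg ae) ler_norml => /andP[h1 h2].
  by apply: gtr0_sg; rewrite lt_neqAle eq_sym abe /=; lra.
- by move: abe; rewrite ae normr0 normr_le0 sub0r oppr_eq0 => /negPf ->.
Qed.

(* The largest multiple of [b] that fits inside [a] kills a coordinate. *)
Lemma exhausting_multiple a b : b != 0 -> vsupp b \subset vsupp a ->
  exists t, (forall e, `|(t *: b) 0 e| <= `|a 0 e|) /\
            exists2 e, b 0 e != 0 & a 0 e = t * b 0 e.
Proof.
rewrite -vsupp_eq0 => /set0Pn[e0]; rewrite inE => be0 /subsetP sba.
have [e1 be1 min1] :=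
  @arg_minP _ R _ e0 (fun e => b 0 e != 0) (fun e => `|a 0 e / b 0 e|) be0.
exists (a 0 e1 / b 0 e1); split; last by exists e1 => //; rewrite divfK.
move=> e; rewrite mxE normrM; have [->|be] := eqVneq (b 0 e) 0.
  by rewrite normr0 mulr0.
by rewrite -ler_pdivlMr ?normr_gt0 // -normf_div min1.
Qed.

Lemma vsupp_sub_proper a b e : vsupp b \subset vsupp a -> b 0 e != 0 ->
  a 0 e = b 0 e -> (#|vsupp (a - b)| < #|vsupp a|)%N.
Proof.
move=> /subsetP sba be ae; apply: proper_card; apply/properP; split.
  apply/subsetP => i; have := sba i; rewrite !inE !mxE.
  have [->|_ _] := eqVneq (a 0 i) 0; last by [].
  by have [->|_ /(_ isT)//] := eqVneq (b 0 i) 0; rewrite subrr eqxx.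
by exists e; rewrite !inE ?mxE ae ?subrr ?eqxx.
Qed.

(** The rows are the unit vectors of [S], so [u *m coord_mx S] extends [u] by zero outside [S]. *)
Definition coord_mx S : 'M[R]_(#|S|, n) := rowsub enum_val 1%:M.

Lemma coord_mx_tr S : coord_mx S *m (coord_mx S)^T = 1%:M.
Proof.
apply/matrixP => i j; rewrite !mxE (bigD1 (enum_val i)) //= !mxE eqxx mul1r.
rewrite big1 => [|k /negPf ki]; last by rewrite !mxE eq_sym ki mul0r.
by rewrite addr0 (inj_eq enum_val_inj) eq_sym.
Qed.

Lemma coord_mx_free S : row_free (coord_mx S).
Proof. by apply/row_freeP; exists (coord_mx S)^T; exact: coord_mx_tr. Qed.

Lemma mul_coord_mx m (M : 'M[R]_(m, n)) S :
  coord_mx S *m M^T = (colsub_set M S)^T.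
Proof.
by rewrite /coord_mx mul_rowsub_mx mul1mx; apply/matrixP => i j; rewrite !mxE.
Qed.

Lemma vsupp_coord_mx S (u : 'rV_#|S|) : vsupp (u *m coord_mx S) \subset S.
Proof.
apply/subsetP => e; apply: contraTT => eS; rewrite inE negbK mxE big1 // => i _.
rewrite !mxE; case: eqP => [ie|_]; last by rewrite mulr0.
by rewrite -ie enum_valP in eS.
Qed.

End Vectors.

(** * Flows of a totally unimodular matrix and conformal unit flows *)

Section TotallyUnimodular.
Context {R : realType} {m n : nat}.
Variable M : 'M[R]_(m, n).
Implicit Types a b x y : 'rV[R]_n.

Lemma flow_kermx x : is_flow M x <-> (x <= kermx M^T)%MS.
Proof.
split=> [xf|/sub_kermxP xf]; last by rewrite /is_flow -(trmxK M) -trmx_mul xf trmx0.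
by apply/sub_kermxP; rewrite -[LHS]trmxK trmx_mul trmxK xf trmx0.
Qed.

Lemma flowD x y : is_flow M x -> is_flow M y -> is_flow M (x + y).
Proof. by rewrite !flow_kermx; exact: addmx_sub. Qed.

Lemma flowZ (t : R) x : is_flow M x -> is_flow M (t *: x).
Proof. by rewrite !flow_kermx; exact: scalemx_sub. Qed.

Lemma flowB x y : is_flow M x -> is_flow M y -> is_flow M (x - y).
Proof. by move=> xf yf; apply: flowD => //; rewrite -scaleN1r; apply: flowZ. Qed.

Hypothesis tuM : totally_unimodular M.

(* Cramer's rule: deleting [e0] leaves independent columns, so the remaining
   coordinates are ratios of minors of [M]. *)
Lemma circuit_coords a e0 : is_flow M a -> a 0 e0 != 0 ->
  (forall b, is_flow M b -> vsupp b \subset vsupp a :\ e0 -> b = 0) ->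
  forall e, a 0 e = 0 \/ a 0 e = a 0 e0 \/ a 0 e = - a 0 e0.
Proof.
move=> af ae0 amin e.
have [->|ae] := eqVneq (a 0 e) 0; first by left.
have [->|ne] := eqVneq e e0; first by right; left.
set T := vsupp a :\ e0 in amin.
have eT : e \in T by rewrite !inE ne.
set A := colsub_set M T.
(* A linear relation between the columns of [A], extended by zero, is a flow supported in [T], hence
   trivial. *)
have fullA : row_full A.
  rewrite /row_full -mxrank_tr -/(row_free A^T) -kermx_eq0; apply/rowV0P => v.
  move=> /sub_kermxP vA.
  have /amin : is_flow M (v *m coord_mx T).
    by apply/flow_kermx/sub_kermxP; rewrite -mulmxA mul_coord_mx.
  by move=> /(_ (vsupp_coord_mx v)) /(congr1 (mulmx^~ (coord_mx T)^T));
     rewrite -mulmxA coord_mx_tr mulmx1 mul0mx.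
pose f := fullrankfun fullA; pose g : 'I_#|T| -> 'I_n := enum_val.
have f_inj : injective f by exact: fullrankfun_inj.
pose B := mxsub f g M.
have BU : B \in unitmx.
  suff -> : B = rowsub f A by exact: fullrowsub_unit.
  by apply/matrixP => i j; rewrite !mxE.
pose j := enum_rank_in eT e.
have gj : g j = e by rewrite /g enum_rankK_in.
(* Exchanging the column of [e] for that of [e0] turns [B] into [B'], the numerator matrix in
   Cramer's rule. *)
pose g' k := if k == j then e0 else g k.
have gT k : g k != e0 by have := enum_valP k; rewrite !inE => /andP[].
have g'_inj : injective g'.
  move=> k l; rewrite /g'; case: eqP => [->|_]; case: eqP => [->|_] //.
  - by move/eqP; rewrite eq_sym (negPf (gT l)).
  - by move/eqP; rewrite (negPf (gT k)).
  - exact: enum_val_inj.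
pose B' := mxsub f g' M.
pose c := \col_i M (f i) e0; pose v := \col_k a 0 (g k).
have Bv : B *m v = - a 0 e0 *: c.
  apply/colP => i; rewrite !mxE.
  have /matrixP/(_ (f i) 0) := af; rewrite !mxE (bigD1 e0) //= mxE mulrC.
  move=> /eqP; rewrite addrC addr_eq0 mulNr => /eqP <-.
  transitivity (\sum_(k in T) M (f i) k * a^T k 0).
    by rewrite [RHS]big_enum_val; apply: eq_bigr => k _; rewrite !mxE.
  rewrite [RHS](bigID (fun k => k \in T)) /= [X in _ = _ + X]big1 ?addr0.
    by apply: eq_bigl => k; rewrite !inE; case: (k == e0).
  move=> k; rewrite !inE => /andP[-> /=]; rewrite negbK => /eqP ak.
  by rewrite mxE ak mulr0.
(* Laplace expansion along column [j]: [B] and [B'] differ only there, so they share the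
   cofactors. *)
have dB' : (\adj B *m c) j 0 = \det B'.
  rewrite (expand_det_col B' j) mxE; apply: eq_bigr => i _.
  rewrite !mxE /g' eqxx mulrC; congr (_ * (_ * \det _)).
  apply/matrixP => k l; rewrite !mxE /g'.
  by rewrite eq_sym (negPf (neq_lift j l)).
have key : \det B * a 0 e = - a 0 e0 * \det B'.
  have /matrixP/(_ j 0) := congr1 (mulmx (\adj B)) Bv.
  rewrite mulmxA mul_adj_mx mul_scalar_mx -scalemxAr [RHS]mxE dB' [LHS]mxE.
  by rewrite [v _ _]mxE gj.
have dB0 : \det B != 0 by rewrite -unitfE -unitmxE.
have dBE : \det B = -1 \/ \det B = 0 \/ \det B = 1 by exact: tuM f_inj enum_val_inj.
have dB'E : \det B' = -1 \/ \det B' = 0 \/ \det B' = 1 by exact: tuM f_inj g'_inj.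
by case: dBE dB'E key dB0 => [->|[->|->]] [->|[->|->]] key dB0;
  try (by case/eqP: dB0); [right; right|left|right; left|right;left|left|right;right]; lra.
Qed.

(** Induction on the size of the support. If a nonzero flow [b] lives on the support without [e0],
    removing its exhausting multiple leaves a flow conformal to [a] with smaller support, nonzero
    because the entry at [e0] is untouched. Otherwise [circuit_coords] applies, and [a] divided by
    the absolute value of [a 0 e0] is the required flow. *)
Lemma conformal_unit_flow a : is_flow M a -> a != 0 ->
  exists mu, [/\ is_flow M mu, mu != 0, conformal mu a
    & forall e, mu 0 e = 0 \/ mu 0 e = 1 \/ mu 0 e = -1].
Proof.
have [k] := ubnP #|vsupp a|; elim: k a => // k IHk a ak af a0.
have [e0 ae0] : exists e, a 0 e != 0.
  by move: a0; rewrite -vsupp_eq0 => /set0Pn[e]; rewrite inE; exists e.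
have [[b [bf b0 sb]]|nob] :=
  pselect (exists b, [/\ is_flow M b, b != 0 & vsupp b \subset vsupp a :\ e0]).
  have be0 : b 0 e0 = 0.
    apply/eqP/negPn/negP => h; have /subsetP/(_ e0) := sb.
    by rewrite !inE eqxx => /(_ h).
  have sba := subset_trans sb (subD1set _ _).
  have [t [tb [e be ate]]] := exhausting_multiple b0 sba.
  have ae : a 0 e != 0 by have /subsetP/(_ e) := sba; rewrite !inE => /(_ be).
  have tbe : (t *: b) 0 e != 0 by rewrite mxE -ate.
  have stb : vsupp (t *: b) \subset vsupp a.
    apply: subset_trans sba; apply/subsetP => i.
    by rewrite !inE mxE; apply: contra_neq => ->; rewrite mulr0.
  have cab := conformal_sub tb.
  have [|||mu [muf mu0 cmu mu1]] := IHk (a - t *: b).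
  - rewrite ltnS in ak; apply: leq_trans ak.
    by apply: (vsupp_sub_proper stb tbe); rewrite mxE.
  - by apply: flowB => //; apply: flowZ.
  - apply/eqP => /rowP/(_ e0); rewrite !mxE be0 mulr0 subr0 => h.
    by rewrite h eqxx in ae0.
  exists mu; split=> //; exact: conformal_trans cab.
exists (`|a 0 e0|^-1 *: a); split.
- exact: flowZ.
- by rewrite scaler_eq0 invr_eq0 normr_eq0 (negPf ae0).
- move=> e _; rewrite mxE sgrM [X in X * _]gtr0_sg ?mul1r //.
  by rewrite invr_gt0 normr_gt0.
move=> e; rewrite mxE.
have [|->|[->|->]] := circuit_coords af ae0 _ e.
- move=> b bf sb; apply/eqP/negPn/negP => b0; apply: nob.
  by exists b.
- by left; rewrite mulr0.
- case: (ltrgtP (a 0 e0) 0) => h; last by rewrite h eqxx in ae0.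
    by right; right; rewrite ltr0_norm // invrN mulNr mulVf.
  by right; left; rewrite gtr0_norm // mulVf.
- case: (ltrgtP (a 0 e0) 0) => h; last by rewrite h eqxx in ae0.
    by right; left; rewrite ltr0_norm // invrN mulrNN mulVf.
  by right; right; rewrite gtr0_norm // mulrN mulVf.
Qed.

(** * Conformal subtraction, the l1 norm and the Voronoi inequalities *)

Lemma scaled_norm_conformal a b t e : conformal b a -> 0 < t ->
  `|(t *: b) 0 e| <= `|a 0 e| -> `|(a - t *: b) 0 e| = `|a 0 e| - t * `|b 0 e|.
Proof.
move=> ba t0; rewrite !mxE; have [->|be] := eqVneq (b 0 e) 0.
  by rewrite mulr0 !subr0 normr0 mulr0 subr0.
have := ba e be; rewrite normrM (gtr0_norm t0).
case: (ltrgtP (b 0 e) 0) be => // b0 _.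
  rewrite (ltr0_sg b0) (ltr0_norm b0) => /esym/eqP; rewrite sgr_cp0 => a0.
  by rewrite (ltr0_norm a0) => h; rewrite ler0_norm; lra.
rewrite (gtr0_sg b0) (gtr0_norm b0) => /esym/eqP; rewrite sgr_cp0 => a0.
by rewrite (gtr0_norm a0) => h; rewrite ger0_norm; lra.
Qed.

Lemma l1norm_sub_conformal a b t : conformal b a -> 0 < t ->
  (forall e, `|(t *: b) 0 e| <= `|a 0 e|) ->
  l1norm (a - t *: b) = l1norm a - t * l1norm b.
Proof.
move=> ba t0 tb; rewrite /l1norm mulr_sumr -sumrB; apply: eq_bigr => e _.
exact: scaled_norm_conformal.
Qed.

(** At the coordinate that gets exhausted, [a] and [b] have the same nonzero sign, so the ratio [t]
    is positive. *)
Lemma conformal_multiple a b : b != 0 -> conformal b a ->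
  exists2 t, 0 < t & (forall e, `|(t *: b) 0 e| <= `|a 0 e|) /\
     (#|vsupp (a - t *: b)| < #|vsupp a|)%N.
Proof.
move=> b0 ba; have sba := conformal_supp ba.
have [t [tb [e be ate]]] := exhausting_multiple b0 sba.
have t0 : 0 < t.
  have ae : a 0 e != 0 by have /subsetP/(_ e) := sba; rewrite !inE => /(_ be).
  rewrite -sgr_gt0 -[t](mulfK be) -ate sgrM sgrV -(ba e be).
  by rewrite -expr2 sqr_sg be.
exists t => //; split => //; apply: (@vsupp_sub_proper _ _ _ _ e); rewrite ?mxE //.
  apply: subset_trans sba; apply/subsetP => i.
  by rewrite !inE mxE; apply: contra_neq => ->; rewrite mulr0.
by rewrite mulf_neq0 // gt_eqF.
Qed.

Lemma unit_flow_int mu : is_flow M mu ->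
  (forall e, mu 0 e = 0 \/ mu 0 e = 1 \/ mu 0 e = -1) -> is_int_flow M mu.
Proof.
move=> muf mu1; split=> // e.
by case: (mu1 e) => [->|[->|->]]; [exists 0|exists 1|exists (-1)].
Qed.

(** Through this identity the Voronoi inequality of a unit flow becomes its l1 bound. *)
Lemma unit_l1norm x : (forall e, x 0 e = 0 \/ x 0 e = 1 \/ x 0 e = -1) ->
  l1norm x = dotp x x.
Proof.
move=> x1; apply: eq_bigr => e _.
by case: (x1 e) => [->|[->|->]]; rewrite ?normrN ?normr0 ?normr1; ring.
Qed.

Lemma voronoi0P x : voronoi0 M x <->
  is_flow M x /\ forall mu, is_int_flow M mu -> 2 * dotp x mu <= dotp mu mu.
Proof.
have normE y : euclid_norm y = Num.sqrt (dotp y y).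
  by congr Num.sqrt; apply: eq_bigr => i _; rewrite expr2.
have sq mu : (euclid_norm x <= euclid_norm (x - mu)) = (2 * dotp x mu <= dotp mu mu).
  rewrite !normE ler_sqrt; last by apply: sumr_ge0 => i _; rewrite -expr2 sqr_ge0.
  rewrite dotpBl !dotpBr (dotpC mu x).
  by apply/idP/idP; lra.
by split=> -[xf xV]; split=> // mu /xV; rewrite sq.
Qed.

(** Both sides are additive when a positive multiple of a conformal unit flow is split off from [a].
    For the unit flow the bound is its Voronoi inequality; the remainder has smaller support. *)
Lemma voronoi0_l1norm x a : voronoi0 M x -> is_flow M a -> 2 * dotp a x <= l1norm a.
Proof.
move=> /voronoi0P[xf xV].
have [k] := ubnP #|vsupp a|; elim: k a => // k IHk a ak af.
have [->|a0] := eqVneq a 0.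
  rewrite /dotp big1 ?mulr0 => [|i _]; last by rewrite mxE mul0r.
  by apply: sumr_ge0.
have [mu [muf mu0 cmu mu1]] := conformal_unit_flow af a0.
have [t t0 [tmu lt_supp]] := conformal_multiple mu0 cmu.
have := IHk (a - t *: mu) (leq_trans lt_supp ak) (flowB af (flowZ t muf)).
rewrite (l1norm_sub_conformal cmu t0 tmu) dotpBl dotpZl (unit_l1norm mu1).
have := xV _ (unit_flow_int muf mu1); rewrite (dotpC x) -(ler_pM2l t0) => h1 h2.
lra.
Qed.

(** A conformal unit flow that vanishes at [e] can be subtracted: this shrinks the support and
    leaves [a 0 e] unchanged, so the search ends. *)
Lemma conformal_unit_flow_at a e : is_flow M a -> a 0 e != 0 ->
  exists mu, [/\ is_flow M mu, mu 0 e != 0, conformal mu a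
    & forall f, mu 0 f = 0 \/ mu 0 f = 1 \/ mu 0 f = -1].
Proof.
have [k] := ubnP #|vsupp a|; elim: k a => // k IHk a ak af ae.
have a0 : a != 0 by apply: contra_neq ae => ->; rewrite mxE.
have [mu [muf mu0 cmu mu1]] := conformal_unit_flow af a0.
have [mue|mue] := eqVneq (mu 0 e) 0; last by exists mu; split.
have [t t0 [tmu lt_supp]] := conformal_multiple mu0 cmu.
have [||nu [nuf nue cnu nu1]] :=
  IHk (a - t *: mu) (leq_trans lt_supp ak).
- by apply: flowB => //; apply: flowZ.
- by rewrite !mxE mue mulr0 subr0.
exists nu; split=> //; apply: conformal_trans cnu _; exact: conformal_sub.
Qed.

(** * Sign vectors of flows and strongly connected orientations *)

Definition sign_vector a : osub n :=
  [ffun e => if a 0 e == 0 then None else Some (0 < a 0 e)].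

Lemma os_supp_sign_vector a : os_supp (sign_vector a) = vsupp a.
Proof. by apply/setP => e; rewrite !inE ffunE; case: (a 0 e == 0). Qed.

Lemma os_sign_sign_vector a e : os_sign R (sign_vector a) e = Num.sg (a 0 e).
Proof.
rewrite /os_sign ffunE; case: (ltrgtP (a 0 e) 0) => [a0|a0|->]; last by rewrite sgr0.
  by rewrite ltr0_sg.
by rewrite gtr0_sg.
Qed.

Lemma os_le_sign_vector a b :
  os_le (sign_vector a) (sign_vector b) <-> conformal b a.
Proof.
rewrite /os_le !os_supp_sign_vector; split=> [[sba ab] e be|ba].
  by rewrite -!os_sign_sign_vector /os_sign ab // inE.
split=> [|e]; first exact: conformal_supp.
rewrite inE => be; rewrite !ffunE (negPf be).
have := ba e be; case: (ltrgtP (b 0 e) 0) be => // b0 _.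
  rewrite (ltr0_sg b0) => /esym/eqP; rewrite sgr_cp0 => a0.
  by rewrite lt_eqF // ltNge ltW.
rewrite (gtr0_sg b0) => /esym/eqP; rewrite sgr_cp0 => a0.
by rewrite gt_eqF // a0.
Qed.

Lemma flow_colsum x : is_flow M x <-> \sum_f x 0 f *: col f M = 0.
Proof.
suff -> : \sum_f x 0 f *: col f M = M *m x^T by [].
apply/colP => i; rewrite summxE mxE; apply: eq_bigr => f _.
by rewrite !mxE mulrC.
Qed.

Lemma flow_strongly_connected a : is_flow M a -> strongly_connected M (sign_vector a).
Proof.
move=> af e; rewrite os_supp_sign_vector inE => ae.
have [mu [muf mue cmu mu1]] := conformal_unit_flow_at af ae.
(* The boolean, read as 0 or 1, is the absolute value of the unit flow at [f]; its sign is that of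
   [a] by conformality. *)
exists (fun f => mu 0 f != 0); split; first by rewrite mue.
move/flow_colsum: muf; rewrite (bigID (mem (vsupp a))) /= [X in _ + X]big1.
  rewrite addr0 => muf; rewrite -[RHS]muf; apply: eq_bigr => f _; congr (_ *: _).
  rewrite os_sign_sign_vector; have [->|muf0] := eqVneq (mu 0 f) 0; first by rewrite mul0r.
  rewrite mul1r -cmu //; case: (mu1 f) => [|[->|->]]; last 2 first.
  - by rewrite sgr1.
  - by rewrite sgrN sgr1.
  - by move=> h; rewrite h eqxx in muf0.
move=> f faS; have /subsetP/(_ f) := conformal_supp cmu.
rewrite [f \in vsupp mu]inE; have [-> _|_ /(_ isT) h] := eqVneq (mu 0 f) 0.
  by rewrite scale0r.
by rewrite h in faS.
Qed.

(** The flow is the sum of one chosen witness per element of the support. All of them carry the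
    signs of [s], so nothing cancels, and the witness of [f] contributes at least one at [f]. *)
Lemma strongly_connected_flow s : strongly_connected M s ->
  exists2 a, is_flow M a & sign_vector a = s.
Proof.
move=> sc.
have [w wP] : {w : 'I_n -> 'I_n -> nat & forall e, e \in os_supp s ->
   (1 <= w e e)%N /\ \sum_(f in os_supp s) ((w e f)%:R * os_sign R s f) *: col f M = 0}.
  apply: (choice (P := fun e (we : 'I_n -> nat) => e \in os_supp s -> (1 <= we e)%N /\
    \sum_(f in os_supp s) ((we f)%:R * os_sign R s f) *: col f M = 0)) => e.
  have [/sc[w wP]|_] := boolP (e \in os_supp s); first by exists w.
  by exists (fun=> 0%N).
pose v e := \row_f ((w e f)%:R * os_sign R s f).
have sign0 f : f \notin os_supp s -> os_sign R s f = 0.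
  by rewrite inE negbK /os_sign => /eqP ->.
have vf e : e \in os_supp s -> is_flow M (v e).
  move=> es; apply/flow_colsum; rewrite (bigID (mem (os_supp s))) /= [X in _ + X]big1.
    rewrite addr0 -[RHS](wP e es).2; apply: eq_bigr => f _.
    by rewrite mxE.
  by move=> f fs; rewrite mxE sign0 // mulr0 scale0r.
exists (\sum_(e in os_supp s) v e).
  by apply/flow_kermx/summx_sub => e es; apply/flow_kermx/vf.
pose W f : R := \sum_(e in os_supp s) (w e f)%:R.
have sumE f : (\sum_(e in os_supp s) v e) 0 f = W f * os_sign R s f.
  by rewrite summxE mulr_suml; apply: eq_bigr => e _; rewrite mxE.
apply/ffunP => f; rewrite ffunE sumE.
have [fs|fs] := boolP (f \in os_supp s); last first.
  by rewrite sign0 // mulr0 eqxx; move: fs; rewrite inE negbK => /eqP.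
have W0 : 0 < W f.
  rewrite /W (bigD1 f) //=; apply: ltr_wpDr.
    by apply: sumr_ge0 => e _; rewrite ler0n.
  by rewrite ltr0n; have [] := wP f fs.
move: fs; rewrite inE /os_sign; case: (s f) => [[]|] // _.
  by rewrite mulr1 gt_eqF // W0.
by rewrite mulrN1 oppr_eq0 gt_eqF // oppr_gt0 ltNge ltW.
Qed.

(** * Orthogonal projection onto the flows and the projected cube *)

Lemma gram_unit k (B : 'M[R]_(k, n)) : row_free B -> B *m B^T \in unitmx.
Proof.
move=> Bfree; rewrite -row_free_unit -kermx_eq0; apply/rowV0P => v /sub_kermxP vB.
apply/eqP; rewrite -(mulmx_free_eq0 _ Bfree) -dotpp_eq0 dotpE trmx_mul mulmxA.
by rewrite -(mulmxA v) vB mul0mx mxE.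
Qed.

(* Orthogonal projection onto the space of flows, acting on row vectors. *)
Definition flow_proj : 'M[R]_n :=
  let K := row_base (kermx M^T) in K^T *m invmx (K *m K^T) *m K.

Lemma flow_proj_sym : flow_proj^T = flow_proj.
Proof.
rewrite /flow_proj; move: (row_base _) => K /=.
by rewrite !trmx_mul trmx_inv trmx_mul !trmxK mulmxA.
Qed.

Lemma flow_proj_flow y : is_flow M (y *m flow_proj).
Proof.
apply/flow_kermx; rewrite /flow_proj mulmxA.
by apply: submx_trans (submxMl _ _) _; rewrite eq_row_base.
Qed.

Lemma kermx_flow_proj k (A : 'M[R]_(k, n)) : (A <= kermx M^T)%MS -> A *m flow_proj = A.
Proof.
move=> AK; have /submxP[u ->] : (A <= row_base (kermx M^T))%MS by rewrite eq_row_base.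
rewrite /flow_proj; have := row_base_free (kermx M^T).
move: (row_base _) u => K u Kfree /=.
by rewrite !mulmxA -(mulmxA u) mulmxK // gram_unit.
Qed.

Lemma dotp_flow_proj a y : is_flow M a -> dotp a (y *m flow_proj) = dotp a y.
Proof.
move=> /flow_kermx/kermx_flow_proj af.
by rewrite !dotpE trmx_mul flow_proj_sym mulmxA af.
Qed.

Lemma eqmx_flow_proj : (flow_proj :=: kermx M^T)%MS.
Proof.
apply/eqmxP/andP; split; last first.
  by rewrite -[X in (X <= _)%MS](kermx_flow_proj (submx_refl _)) submxMl.
by rewrite /flow_proj; apply: submx_trans (submxMl _ _) _; rewrite eq_row_base.
Qed.

(** For [y] in the cube [-1, 1]^E these are the points of the projection of [-1/2, 1/2]^E. *)
Definition zonotope_point y := 2^-1 *: (y *m flow_proj).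

Lemma dotp_zonotope_point a y : is_flow M a -> 2 * dotp a (zonotope_point y) = dotp a y.
Proof.
by move=> af; rewrite dotpC dotpZl dotpC dotp_flow_proj // mulVKf // pnatr_eq0.
Qed.

(** An integer satisfies |z| <= z^2, whence <mu, y> <= |mu|_1 <= <mu, mu>. *)
Lemma voronoi0_zonotope_point y : (forall e, `|y 0 e| <= 1) ->
  voronoi0 M (zonotope_point y).
Proof.
move=> y1; apply/voronoi0P; split; first exact/flowZ/flow_proj_flow.
move=> mu [muf muZ]; rewrite dotpC dotp_zonotope_point //; apply: ler_sum => e _.
have [z ->] := muZ e; apply: le_trans (ler_norm _) _; rewrite normrM.
apply: le_trans (ler_piMr (normr_ge0 _) (y1 e)) _.
have [->|z0] := eqVneq z 0; first by rewrite normr0 mul0r.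
rewrite -expr2 -real_normK ?num_real // expr2 ler_peMr // -intr_norm ler1z.
by rewrite -gtz0_ge1 normr_gt0.
Qed.

(** * Faces of the Voronoi cell and their inclusions *)

Definition flow_face a x : Prop := voronoi0 M x /\ 2 * dotp a x = l1norm a.

Lemma flow_face_zonotope_point a y : is_flow M a -> (forall e, `|y 0 e| <= 1) ->
  (forall e, a 0 e != 0 -> y 0 e = Num.sg (a 0 e)) -> flow_face a (zonotope_point y).
Proof.
move=> af y1 ya; split; first exact: voronoi0_zonotope_point.
rewrite dotp_zonotope_point //; apply: eq_bigr => e _.
have [->|ae] := eqVneq (a 0 e) 0; first by rewrite mul0r normr0.
by rewrite ya // mulrC -normrEsg.
Qed.

Definition sgrow a : 'rV[R]_n := \row_e Num.sg (a 0 e).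

Lemma norm_sgrow_le1 a e : `|sgrow a 0 e| <= 1.
Proof. by rewrite mxE normr_sg lern1 leq_b1. Qed.

Lemma flow_face_center a : is_flow M a -> flow_face a (zonotope_point (sgrow a)).
Proof.
by move=> af; apply: flow_face_zonotope_point => // e; [exact: norm_sgrow_le1|rewrite mxE].
Qed.

Lemma is_face_flow_face a : is_flow M a -> is_face (voronoi0 M) (flow_face a).
Proof.
move=> af; split; first by eexists; exact: flow_face_center.
exists a, (l1norm a / 2); split=> [x xV|x].
  by have := voronoi0_l1norm xV af; lra.
by split=> -[xV ax]; split=> //; lra.
Qed.

(** Projecting the normal onto the flows keeps its values on the cell. The level is then forced: a
    nonempty face attains it, and the point of [flow_face_center] attains the l1 bound. *)
Lemma is_faceP F : is_face (voronoi0 M) F ->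
  exists2 a, is_flow M a & F = flow_face a.
Proof.
move=> [[x0 Fx0] [a0 [b [supp_b FE]]]].
pose a := a0 *m flow_proj; have af : is_flow M a := flow_proj_flow a0.
have aE x : voronoi0 M x -> dotp a0 x = dotp a x.
  by move=> [xf _]; rewrite [RHS]dotpC dotp_flow_proj // dotpC.
have bE : 2 * b = l1norm a.
  apply/eqP; rewrite eq_le; apply/andP; split.
    have [xV <-] := (FE x0).1 Fx0; rewrite aE //; exact: voronoi0_l1norm.
  have [xV <-] := flow_face_center af; rewrite -aE //.
  by rewrite ler_pM2l ?ltr0n // supp_b.
exists a => //; apply/funext => x; apply/propext; rewrite FE.
by split=> -[xV h]; split=> //; move: h; rewrite aE //; lra.
Qed.

(** Forward, the inclusion is tested at the center of [flow_face a]: the terms |b_e| - b_e sg(a_e)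
    are nonnegative with sum zero. Backward, the bound for [a] is the bound for [a - t *: b] plus
    [t] times that for [b], so equality for [a] forces equality for [b]. *)
Lemma flow_face_sub a b : is_flow M a -> is_flow M b ->
  (forall x, flow_face a x -> flow_face b x) <-> conformal b a.
Proof.
move=> af bf; split=> [sub|ba x [xV ax]].
  have [_] := sub _ (flow_face_center af); rewrite dotp_zonotope_point // => /eqP.
  rewrite -subr_eq0 -oppr_eq0 opprB -sumrB psumr_eq0 => [/allP eq0 e be|e _]; last first.
    rewrite subr_ge0; apply: le_trans (ler_norm _) _; rewrite normrM.
    by apply: ler_piMr => //; exact: norm_sgrow_le1.
  have := eq0 e (mem_index_enum _); rewrite mxE subr_eq0 [X in X == _]normrEsg mulrC.
  by rewrite (inj_eq (mulfI be)) => /eqP.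
split=> //; have [->|b0] := eqVneq b 0.
  by rewrite /dotp /l1norm !big1 ?mulr0 // => i _; rewrite !mxE ?normr0 ?mul0r.
have [t t0 [tb _]] := conformal_multiple b0 ba.
have := voronoi0_l1norm xV (flowB af (flowZ t bf)).
rewrite (l1norm_sub_conformal ba t0 tb) dotpBl dotpZl => h.
apply/eqP; rewrite eq_le (voronoi0_l1norm xV bf) /= -(ler_pM2l t0).
lra.
Qed.

Lemma os_le_anti (s s' : osub n) : os_le s s' -> os_le s' s -> s = s'.
Proof.
move=> [s's e1] [ss' e2]; apply/ffunP => e.
have [es|] := boolP (e \in os_supp s); first exact: e2.
move=> es; have : e \notin os_supp s' by apply: contra es; exact/subsetP.
by move: es; rewrite !inE !negbK => /eqP -> /eqP ->.
Qed.

Lemma flow_face_sign_vector a b : is_flow M a -> is_flow M b ->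
  flow_face a = flow_face b -> sign_vector a = sign_vector b.
Proof.
move=> af bf E.
by apply: os_le_anti; apply/os_le_sign_vector/flow_face_sub => //; rewrite E.
Qed.

(** The signs of [b] may disagree with those of [a], but for some nonzero [t] the flow [a - t *: b]
    is conformal to [a]. Its inner product is therefore constant on the face, as is that of [a], and
    the difference is [t] times that of [b]. *)
Lemma flow_face_dotp_const a b x y : is_flow M a -> is_flow M b ->
  vsupp b \subset vsupp a -> flow_face a x -> flow_face a y -> dotp b x = dotp b y.
Proof.
move=> af bf sba xa ya; have [->|b0] := eqVneq b 0.
  by rewrite /dotp !big1 // => i _; rewrite mxE mul0r.
have [t [tb [e be ate]]] := exhausting_multiple b0 sba.
have t0 : t != 0.
  apply: contraTneq be => t0; have /subsetP/(_ e) := sba.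
  by rewrite !inE ate t0 mul0r eqxx; case: (b 0 e == 0) => //= /(_ isT).
have sub := (flow_face_sub af (flowB af (flowZ t bf))).2 (conformal_sub tb).
have [_] := sub x xa; have [_] := sub y ya.
rewrite !dotpBl !dotpZl; have [_ hx] := xa; have [_ hy] := ya => h1 h2.
by apply: (mulfI t0); lra.
Qed.

(** * Dimension of the faces *)

Definition off_mx (S : {set 'I_n}) : 'M[R]_n := diag_mx (\row_e (e \notin S)%:R).

Lemma eqmx_coord_mx S : (coord_mx S :=: kermx (off_mx S))%MS.
Proof.
apply/eqmxP/andP; split.
  apply/sub_kermxP; rewrite mul_rowsub_mx mul1mx.
  apply/matrixP => i j; by rewrite !mxE enum_valP mul0rn.
(* The identity splits into the coordinates outside and inside [S]; the first part annihilates the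
   kernel. *)
have split1 : 1%:M = off_mx S + (coord_mx S)^T *m coord_mx S.
  apply/matrixP => i j; rewrite !mxE.
  transitivity ((i \notin S)%:R *+ (i == j) +
    \sum_(k in S) (k == i)%:R * (k == j)%:R : R); last first.
    by congr (_ + _); rewrite [LHS]big_enum_val; apply: eq_bigr => k _; rewrite !mxE.
  have [iS|iS] := boolP (i \in S).
    rewrite (bigD1 i) //= eqxx mul1r big1 ?mul0rn ?add0r ?addr0 //.
    by move=> k /andP[_ /negPf ->]; rewrite mul0r.
  rewrite big1 ?addr0 // => k kS; case: eqP => [ki|_]; last by rewrite mul0r.
  by rewrite -ki kS in iS.
rewrite -[X in (X <= _)%MS]mulmx1 split1 mulmxDr.
by have /sub_kermxP -> := submx_refl (kermx (off_mx S)); rewrite add0r mulmxA submxMl.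
Qed.

Lemma sub_kermx_off_mx S v : (v <= kermx (off_mx S))%MS -> vsupp v \subset S.
Proof. by rewrite -eqmx_coord_mx => /submxP[u ->]; exact: vsupp_coord_mx. Qed.

(** Extension by zero identifies the kernel of the column submatrix with the flows supported in
    [S]. *)
Lemma rank_kermx_off_mx S :
  \rank (kermx M^T :&: kermx (off_mx S)) = \rank (kermx (colsub_set M S)^T).
Proof.
rewrite -mul_coord_mx mxrank_ker.
have rkS : \rank (coord_mx S : 'M[R]_(_, n)) = #|S| by apply/eqP; exact: coord_mx_free.
rewrite -[X in (X - _)%N]rkS.
rewrite -(mxrank_mul_ker (coord_mx S) M^T) addKn capmxC.
by rewrite (cap_eqmx (eqmx_coord_mx S) (eqmx_refl _)).
Qed.

(** Since [flow_proj] is symmetric, transposing turns the product into [off_mx S] acting on the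
    space of flows, where rank-nullity applies. *)
Lemma rank_off_flow_proj S :
  (\rank (off_mx S *m flow_proj) + \rank (kermx M^T :&: kermx (off_mx S)))%N = genus M.
Proof.
rewrite -mxrank_tr trmx_mul flow_proj_sym tr_diag_mx (eqmxMr _ eqmx_flow_proj).
exact: mxrank_mul_ker.
Qed.

(** Outside the support of [a] the row [sgrow a] is 0, and raising one such entry to 1 stays in the
    cube and on the face. The displacements are halves of projected unit vectors, from which a
    maximal independent family is taken. *)
Lemma aff_indep_flow_face a : is_flow M a ->
  aff_indep_in (flow_face a) (\rank (off_mx (vsupp a) *m flow_proj)).
Proof.
move=> af; set A := off_mx _ *m _.
exists (zonotope_point (sgrow a)), (2^-1 *: rowsub (maxrankfun A) A).
split; first exact: flow_face_center.
split=> [i|]; last first.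
  rewrite /row_free mxrank_scale_nz ?invr_eq0 ?pnatr_eq0 //.
  exact: maxrowsub_free.
rewrite linearZ /= row_rowsub row_mul -scalerDr -mulmxDl.
set e0 := maxrankfun A i.
have offE e : row e0 (off_mx (vsupp a)) 0 e = ((e == e0) && (a 0 e == 0))%:R.
  rewrite !mxE inE negbK [e0 == e]eq_sym; have [->|_] := eqVneq e e0.
    by rewrite mulr1n.
  by rewrite mulr0n.
apply: flow_face_zonotope_point => // e; rewrite mxE offE mxE.
  have [->|_] := eqVneq (a 0 e) 0; first by rewrite sgr0 add0r andbT normr_nat lern1 leq_b1.
  by rewrite andbF addr0 normr_sg lern1 leq_b1.
by move=> /negPf ->; rewrite andbF addr0.
Qed.

(** By [flow_face_dotp_const] the directions of the face are orthogonal to the space [L] of flows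
    supported in [S]. They thus meet it trivially, and the two dimensions add up to at most the
    genus. *)
Lemma aff_indep_flow_face_le a d : is_flow M a -> aff_indep_in (flow_face a) d ->
  (d <= \rank (off_mx (vsupp a) *m flow_proj))%N.
Proof.
move=> af [p0 [Q [p0a [Qa /eqP <-]]]]; set S := vsupp a.
set L := (kermx M^T :&: kermx (off_mx S))%MS.
have rowE i : row i Q = (p0 + row i Q) - p0 by rewrite addrC addKr.
have QK : (Q <= kermx M^T)%MS.
  apply/row_subP => i; apply/flow_kermx; rewrite rowE.
  by apply: flowB; [have [[]] := Qa i|have [[]] := p0a].
have QL : Q *m L^T = 0.
  apply/matrixP => i j; have := row_sub j L; rewrite sub_capmx => /andP[jK joff].
  transitivity (dotp (row j L) (row i Q)).
    by rewrite mxE; apply: eq_bigr => k _; rewrite !mxE mulrC.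
  rewrite rowE dotpBr mxE; apply/eqP; rewrite subr_eq0; apply/eqP.
  apply: (flow_face_dotp_const af) => //; first exact/flow_kermx.
  exact: sub_kermx_off_mx.
have QL0 : (Q :&: L)%MS = 0.
  apply/eqP/rowV0P => v; rewrite sub_capmx => /andP[/submxP[u vE] /submxP[w vE']].
  apply/eqP; rewrite -dotpp_eq0 dotpE {1}vE vE' trmx_mul mulmxA -(mulmxA u) QL.
  by rewrite mulmx0 mul0mx mxE.
rewrite -(leq_add2r (\rank L)) rank_off_flow_proj -(mxrank_disjoint_sum QL0).
by apply: mxrankS; rewrite addsmx_sub QK capmxSl.
Qed.

Lemma flow_face_dim a : is_flow M a -> exists d, has_affdim (flow_face a) d /\
  (d + os_genus M (sign_vector a))%N = genus M.
Proof.
move=> af; exists (\rank (off_mx (vsupp a) *m flow_proj)); split.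
  by split=> [|d]; [exact: aff_indep_flow_face|exact: aff_indep_flow_face_le].
by rewrite /os_genus os_supp_sign_vector -rank_kermx_off_mx rank_off_flow_proj.
Qed.

End TotallyUnimodular.

Theorem mainTheorem1 (R : realType) (m n : nat) (M : 'M[R]_(m, n)) :
  totally_unimodular M ->
  exists phi : {F : 'rV[R]_n -> Prop | is_face (voronoi0 M) F} ->
               {s : osub n | strongly_connected M s},
    bijective phi /\
    (forall F G : {F : 'rV[R]_n -> Prop | is_face (voronoi0 M) F},
        ((forall x, sval F x -> sval G x) <-> os_le (sval (phi F)) (sval (phi G)))) /\
    (forall F : {F : 'rV[R]_n -> Prop | is_face (voronoi0 M) F},
        exists d, has_affdim (sval F) d /\ (d + os_genus M (sval (phi F)))%N = genus M).
Proof.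
move=> tuM.
pose fl (F : {F | is_face (voronoi0 M) F}) := cid2 (is_faceP tuM (svalP F)).
have flf F : is_flow M (s2val (fl F)) := s2valP (fl F).
have flE F : sval F = flow_face M (s2val (fl F)) := s2valP' (fl F).
pose phi F : {s | strongly_connected M s} :=
  exist _ (sign_vector (s2val (fl F))) (flow_strongly_connected tuM (flf F)).
have phi_le F G : (forall x, sval F x -> sval G x) <-> os_le (sval (phi F)) (sval (phi G)).
  by rewrite /= os_le_sign_vector -(flow_face_sub tuM) // -!flE.
have phi_inj : injective phi.
  move=> F G FG; have : sval F = sval G.
    apply/funext => x; apply/propext.
    by split; move: x; apply/phi_le; rewrite FG; split.
  by case: F G {FG} => [F Ff] [G Gf] /= FG; exact: eq_exist.
pose gl (s : {s | strongly_connected M s}) := cid2 (strongly_connected_flow (svalP s)).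
pose psi s : {F | is_face (voronoi0 M) F} :=
  exist _ (flow_face M (s2val (gl s))) (is_face_flow_face tuM (s2valP (gl s))).
have psiK : cancel psi phi.
  move=> s; suff : sval (phi (psi s)) = sval s.
    by case: s (phi _) => [s ss] [s' ss'] /= E; exact: eq_exist.
  (* The flow chosen for the face [psi s] may differ from the one chosen for [s], but both define
     the same face and so have the same sign vector. *)
  rewrite -[RHS](s2valP' (gl s)).
  exact: (flow_face_sign_vector tuM (flf _) (s2valP (gl s)) (esym (flE (psi s)))).
exists phi; split; last split => //.
  by exists psi => // F; apply: phi_inj; rewrite psiK.
move=> F; have [d [dF dE]] := flow_face_dim tuM (flf F).
by exists d; split; first by rewrite (flE F).
Qed.
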